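(* Let $n\ge 2$, let $TT_n$ be the transitive tournament on $n$ vertices, and let $\alpha=(\alpha_1,\dots,\alpha_s)\in\mathbb{K}_s$ with $\sum_{i=1}^s|\alpha_i|=n-1$. Then the number $f_{TT_n}(\alpha)$ of oriented (Hamiltonian) paths of type $P(\alpha)$ in $TT_n$ equals $\mathcal{F}(\alpha)$ if $\alpha$ is non-symmetric, and equals $\frac{1}{2}\mathcal{F}(\alpha)$ if $\alpha$ is symmetric.
   Context: A tournament is an orientation of a complete graph. The transitive tournament $TT_n$ has vertices $v_1,\dots,v_n$ and arcs $(v_i,v_j)$ for all $i<j$. For $s\ge1$, $\mathbb{K}_s=\{(\alpha_1,\dots,\alpha_s)\in\mathbb{Z}^s:\ \alpha_i\alpha_{i+1}<0 \text{ for all } 1\le i\le s-1\}$ (in particular, when $s\ge 2$ all entries are nonzero and signs alternate; we take all entries nonzero). An oriented path is a digraph whose underlying graph is a path; a block is a maximal directed subpath. An oriented path $P$ is of type $P(\alpha_1,\dots,\alpha_s)$ if $P$ is the concatenation of $s$ blocks $I_1,\dots,I_s$, where $I_i$ has ends $x_i,y_i$, $I_i\cap I_{i+1}=\{y_i\}=\{x_{i+1}\}$, $I_i$ has length $|\alpha_i|$, and $\alpha_i>0$ iff $I_i$ is directed from $x_i$ to $y_i$. $f_T(\alpha)$ denotes the number of (distinct, i.e. with distinct arc sets) oriented paths of type $P(\alpha)$ in $T$. For $\alpha=(\alpha_1,\dots,\alpha_s)$, write $-\alpha=(-\alpha_1,\dots,-\alpha_s)$ and $\overline{\alpha}=(\alpha_s,\dots,\alpha_1)$;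 $\alpha$ is symmetric if $\alpha=-\overline{\alpha}$. The path-function $\mathcal{F}$ on tuples in $\bigcup_{s\ge1}\mathbb{K}_s$ (with nonzero entries) is defined recursively: $\mathcal{F}(\alpha_1)=1$ for every nonzero integer $\alpha_1$; for $s\ge2$, $\mathcal{F}(\alpha_1,\dots,\alpha_s)=\sum_{i=1}^s\mathcal{F}(\alpha_1,\dots,\alpha_{i-1},\alpha_i*1,\alpha_{i+1},\dots,\alpha_s)$, where $\alpha_i*1=\alpha_i-1$ if $\alpha_i>0$ and $\alpha_i*1=\alpha_i+1$ if $\alpha_i<0$, and where a tuple containing a zero entry is reduced by the rules $\mathcal{F}(0,\alpha_2,\dots,\alpha_t)=\mathcal{F}(\alpha_2,\dots,\alpha_t)$, $\mathcal{F}(\alpha_1,\dots,\alpha_{t},0)=\mathcal{F}(\alpha_1,\dots,\alpha_{t})$, and $\mathcal{F}(\alpha_1,\dots,\alpha_r,0,\alpha_{r+2},\dots,\alpha_s)=\mathcal{F}(\alpha_1,\dots,\alpha_{r-1},\alpha_r+\alpha_{r+2},\alpha_{r+3},\dots,\alpha_s)$ (here $\alpha_r,\alpha_{r+2}$ have the same sign). *)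

(* Defs.v *)
From mathcomp Require Import all_boot all_order all_algebra.
Set Implicit Arguments. Unset Strict Implicit. Unset Printing Implicit Defensive.
Import Order.TTheory GRing.Theory Num.Theory.

Definition inK (a : seq int) : bool :=
  [&& (0 < size a)%N, all (fun x => x != 0%R) a &
      all (fun p => (p.1 * p.2 < 0)%R) (zip a (behead a))].

Definition lenK (a : seq int) : nat := sumn [seq absz x | x <- a].

(* direction of each successive edge of a path of type P(alpha):
   true = edge directed forward (from x_k to x_{k+1}) *)
Definition dirs (a : seq int) : seq bool :=
  flatten [seq nseq (absz x) (0 < x)%R | x <- a].

Definition edges (V : Type) (x : seq V) : seq (V * V) := zip x (behead x).

(* A vertex sequence x is an oriented path of type P(alpha) in the digraph T:
   distinct vertices, right length, and each edge is an arc of T in the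
   direction prescribed by alpha.  (Since alpha alternates in sign, the
   blocks are automatically maximal.) *)
Definition is_typed_path (V : finType) (T : rel V) (a : seq int) (x : seq V) : bool :=
  [&& uniq x, size x == (size (dirs a)).+1 &
      all2 (fun p d => if d then T p.1 p.2 else T p.2 p.1) (edges x) (dirs a)].

Definition arcset (V : finType) (a : seq int) (x : seq V) : {set V * V} :=
  [set e | e \in [seq if pd.2 then pd.1 else (pd.1.2, pd.1.1)
                 | pd <- zip (edges x) (dirs a)]].

Definition fT (V : finType) (T : rel V) (a : seq int) : nat :=
  #|[set arcset a (val t) | t : (size (dirs a)).+1.-tuple V
                          & is_typed_path T a (val t)]|.

Definition TT (n : nat) : rel 'I_n := fun i j => (i < j)%N.
Arguments TT n : clear implicits.

Definition star1 (x : int) : int := if (0 < x)%R then (x - 1)%R else (x + 1)%R.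

Definition Fstep (i : nat) (a : seq int) : seq int :=
  let y := star1 (nth 0%R a i) in
  if y != 0%R then set_nth 0%R a i y
  else if i == 0%N then behead a
  else if i == (size a).-1 then take (size a).-1 a
  else take i.-1 a ++ (nth 0%R a i.-1 + nth 0%R a i.+1)%R :: drop i.+2 a.

Fixpoint Ffuel (k : nat) (a : seq int) : nat :=
  match k with
  | 0 => 1
  | k'.+1 => if (size a <= 1)%N then 1
             else sumn [seq Ffuel k' (Fstep i a) | i <- iota 0 (size a)]
  end.

(* The path-function F; fuel = sum |alpha_i| suffices since each step
   decreases it by exactly one. *)
Definition PF (a : seq int) : nat := Ffuel (lenK a) a.

Definition sym_tuple (a : seq int) : bool := a == [seq (- x)%R | x <- rev a].

(* Main.v *)
(* A Hamiltonian path of type P(alpha) in TT_n is a permutation of the vertices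
   whose up/down pattern is the word of directions of alpha, taken up to
   reversal. The maximal vertex sits at a peak of the pattern, and deleting it
   merges the adjacent ascent and descent (if both exist) into one step, which
   may go either way: this shortens one of the blocks meeting at the peak. Every
   block ends at exactly one peak, so the number of permutations with a given
   pattern satisfies the recursion of the path-function, one summand per block.
   Finally, an arc set determines its path up to reversal, and the reversed path
   has the same type exactly when alpha is symmetric. *)
Require Import Defs.
From mathcomp Require Import all_boot all_order all_algebra zify.
Set Implicit Arguments. Unset Strict Implicit. Unset Printing Implicit Defensive.
Import Order.TTheory GRing.Theory Num.Theory.

(** * Counting permutations with a given pattern by removing the maximum *)

Definition pattern (x : seq nat) : seq bool := [seq p.1 < p.2 | p <- edges x].

Fixpoint insertions (v : nat) (x : seq nat) : seq (seq nat) :=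
  if x is y :: x' then (v :: x) :: [seq y :: z | z <- insertions v x']
  else [:: [:: v]].

(* The patterns obtained from one of pattern [d] by inserting a new maximum,
   anywhere but in front for [peak_insertions_tail]. *)
Fixpoint peak_insertions_tail (d : seq bool) : seq (seq bool) :=
  if d is b :: d' then
    [:: true, false & d'] :: [seq b :: e | e <- peak_insertions_tail d']
  else [:: [:: true]].

Definition peak_insertions (d : seq bool) : seq (seq bool) :=
  (false :: d) :: peak_insertions_tail d.

(* The words obtained by shortening one maximal run of [d] by one letter. *)
Fixpoint run_deletions (d : seq bool) : seq (seq bool) :=
  if d is b :: d' then
    (if ohead d' == Some b then id else cons d')
      [seq b :: e | e <- run_deletions d']
  else [::].

Definition num_pattern (d : seq bool) : nat :=
  count (fun x => pattern x == d) (permutations (iota 0 (size d).+1)).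

Lemma count_mem_map_cons (T : eqType) (b c : T) (d : seq T) s :
  count_mem (c :: d) [seq b :: e | e <- s] = (b == c) * count_mem d s.
Proof.
rewrite count_map; case: eqVneq => [->|neq]; rewrite ?mul1n ?mul0n.
  by apply: eq_count => e /=; rewrite eqseq_cons eqxx.
by apply/eqP; rewrite -leqn0 leqNgt -has_count; apply/hasPn => e _ /=;
   rewrite eqseq_cons (negPf neq).
Qed.

Lemma count_mem_nil_map_cons (T : eqType) (b : T) s :
  count_mem [::] [seq b :: e | e <- s] = 0.
Proof. by rewrite count_map; elim: s. Qed.

(** Undoing an insertion merges the [true, false] at a peak into one letter, which shortens the run
    of the other letter; a descent at the front or an ascent at the end is dropped, which shortens
    the run at that end. Each run has exactly one end at a peak, so every run is shortened once. *)
Lemma count_peak_insertions (d d' : seq bool) :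
  count_mem d (peak_insertions d') = count_mem d' (run_deletions d).
Proof.
elim: d d' => [|c d IHd] [|b d'] //=.
- by rewrite count_mem_nil_map_cons.
- by rewrite !eqseq_cons; case: c; case: d {IHd} => [|[] [|? ?]] //=;
    rewrite ?count_mem_nil_map_cons ?addn0.
(* Removing the leading [c] counts by itself only if its run has length one; a longer first run is
   already shortened inside [d]. *)
have rhsE : count_mem (b :: d') (run_deletions (c :: d)) =
    (ohead d != Some c) && (d == b :: d') + (c == b) * count_mem d (peak_insertions d').
  rewrite IHd /=; case: eqP => /= _; by rewrite count_mem_map_cons.
rewrite -/(run_deletions (c :: d)) rhsE count_mem_map_cons /=.
rewrite !eqseq_cons (eq_sym (false :: d')) (eq_sym (b :: d')) (eq_sym b c).
by case: c {rhsE}; case: b; case: d {IHd} => [|[] d] //=;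
  rewrite ?eqseq_cons /= ?addn0 ?add0n ?mul1n ?mul0n //= ?addn0.
Qed.

(** The form [y :: x] matters: the empty sequence has one insertion, while [peak_insertions [::]]
    distinguishes the front from the end. *)
Lemma pattern_insertions (v y : nat) (x : seq nat) :
  all (fun z => z < v) (y :: x) ->
  [seq pattern z | z <- insertions v (y :: x)] =
  peak_insertions (pattern (y :: x)).
Proof.
have patE u w z : pattern [:: u, w & z] = (u < w) :: pattern (w :: z) by [].
move=> ltv; rewrite /peak_insertions /= patE; congr (_ :: _).
  by case/andP: ltv => lt_yv _; rewrite ltnNge (ltnW lt_yv).
elim: x y ltv => [|z x IHx] y /=; first by rewrite /pattern /= => /andP[->].
case/andP=> lt_yv /andP[lt_zv ltv]; congr (_ :: _).
  by rewrite !patE lt_yv ltnNge (ltnW lt_zv).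
move: (IHx z); rewrite /= lt_zv ltv => /(_ isT) <-.
by rewrite -!map_comp; apply: eq_map => w /=; rewrite patE.
Qed.

(** As [v] is not in [x], it occurs once after insertion and [rem v] undoes the insertion, so no
    result is produced twice. *)
Lemma count_insertions (v : nat) (x y : seq nat) :
  v \notin x ->
  count_mem y (insertions v x) = (v \in y) && (rem v y == x).
Proof.
elim: x y => [|z x IHx] y /=.
  move=> _; rewrite addn0; case: y => [|u y] //=.
  rewrite eqseq_cons in_cons (eq_sym v u); case: (eqVneq u v) => /= _.
    by rewrite eq_sym.
  by rewrite andbF.
rewrite in_cons negb_or => /andP[neq_vz vNx].
case: y => [|u y]; first by rewrite count_mem_nil_map_cons.
rewrite count_mem_map_cons IHx // eqseq_cons in_cons /= (eq_sym u v).
case: (eqVneq v u) => /= [<-|neq_vu].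
  by rewrite (eq_sym z v) (negPf neq_vz) addn0 eq_sym.
by rewrite add0n eqseq_cons (eq_sym z u) andbCA mulnb.
Qed.

Lemma perm_permutations_iotaS (n : nat) :
  perm_eq (permutations (iota 0 n.+1))
          (flatten [seq insertions n x | x <- permutations (iota 0 n)]).
Proof.
apply/allP => /= y _; apply/eqP.
rewrite count_uniq_mem ?permutations_uniq // mem_permutations.
rewrite count_flatten -map_comp.
have -> : [seq (count_mem y \o insertions n) x | x <- permutations (iota 0 n)]
   = [seq (n \in y) * (rem n y == x) | x <- permutations (iota 0 n)].
  apply/eq_in_map => x; rewrite mem_permutations => /perm_mem xE /=.
  rewrite count_insertions ?mulnb // xE mem_iota; lia.
(* Brings [n] to the front of [iota 0 n.+1], so that [rem n y] can be compared with [iota 0 n]. *)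
rewrite -[0 :: _]/(iota 0 n.+1) -[n.+1]addn1 iotaD add0n perm_sym cats1 perm_rcons perm_sym.
case nin: (n \in y); last first.
  rewrite (_ : perm_eq _ _ = false); first by elim: (permutations _).
  by apply: contraFF nin => /perm_mem ->; rewrite mem_head.
rewrite (permPl (perm_to_rem nin)) perm_cons -mem_permutations.
rewrite -count_uniq_mem ?permutations_uniq //.
by elim: (permutations _) => //= x s ->; rewrite mul1n eq_sym.
Qed.

Lemma size_run_deletions (d e : seq bool) :
  e \in run_deletions d -> size d = (size e).+1.
Proof.
elim: d e => //= b d IHd e.
have tailP : e \in [seq b :: f | f <- run_deletions d] -> (size d).+1 = (size e).+1.
  by case/mapP=> f /IHd -> ->.
by case: ifP => //= _; rewrite in_cons => /orP[/eqP -> //|/tailP].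
Qed.

Lemma num_pattern_rec (d : seq bool) :
  0 < size d ->
  num_pattern d = sumn [seq num_pattern e | e <- run_deletions d].
Proof.
move=> d_gt0; rewrite /num_pattern; case def_n: (size d) d_gt0 => [//|n] _.
rewrite (permP (perm_permutations_iotaS _)) count_flatten -map_comp.
(* Inserting the maximum [n.+1] into [x] yields pattern [d] as often as the pattern of [x] occurs
   among the run deletions of [d]. *)
have -> : [seq (count (fun x => pattern x == d) \o insertions n.+1) x
            | x <- permutations (iota 0 n.+1)] =
          [seq \sum_(e <- run_deletions d) (pattern x == e)
            | x <- permutations (iota 0 n.+1)].
  apply/eq_in_map => x; rewrite mem_permutations => xP /=.
  have := perm_size xP; rewrite size_iota.
  case: x xP => [//|y x] xP _.
  rewrite -(count_map pattern (pred1 d)) pattern_insertions; last first.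
    by apply/allP => z; rewrite (perm_mem xP) mem_iota.
  rewrite count_peak_insertions -sum1_count [LHS]big_mkcond /=.
  by apply: eq_bigr => e _; rewrite eq_sym; case: eqP.
(* After the exchange of sums, each run deletion [e] has length [n], so its inner sum is
   [num_pattern e]. *)
rewrite !sumnE !big_map exchange_big /= big_seq [RHS]big_seq.
apply: eq_bigr => e /size_run_deletions; rewrite def_n => -[<-].
by rewrite -sum1_count [RHS]big_mkcond; apply: eq_bigr => x _; case: eqP.
Qed.

(** * The path-function as a number of permutations *)

Definition alternating (a : seq int) : bool :=
  all (fun x => x != 0%R) a && sorted (fun b c => b != c) [seq (0 < x)%R | x <- a].

(** Without non-emptiness the condition passes to tails, and its signs are the letters that [dirs]
    repeats. *)
Lemma inKE (a : seq int) : inK a = (0 < size a) && alternating a.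
Proof.
rewrite /inK /alternating; congr (_ && _).
case: a => //= x a; elim: a x => //= y a IHa x.
have := IHa y; case: (eqVneq x 0%R) => //= x0; case: (eqVneq y 0%R) => //= y0.
case: (all _ a) => //= ->; congr (_ && _); nia.
Qed.

Lemma dirs_cat (a b : seq int) : dirs (a ++ b) = dirs a ++ dirs b.
Proof. by rewrite /dirs map_cat flatten_cat. Qed.

Lemma dirs_cons (x : int) (a : seq int) : dirs (x :: a) = nseq `|x|%N (0 < x)%R ++ dirs a.
Proof. by []. Qed.

Lemma size_dirs (a : seq int) : size (dirs a) = lenK a.
Proof. by elim: a => //= x a IHa; rewrite dirs_cons size_cat size_nseq IHa. Qed.

Lemma ohead_dirs (a : seq int) :
  alternating a -> ohead (dirs a) = ohead [seq (0 < x)%R | x <- a].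
Proof.
case: a => //= x a /andP[/= /andP[x0 _] _]; rewrite dirs_cons.
by case: absz (absz_eq0 x) => [|m]; rewrite (negPf x0).
Qed.

Lemma alternating_cons x a :
  alternating (x :: a) =
  [&& x != 0%R, alternating a & ohead [seq (0 < y)%R | y <- a] != Some (0 < x)%R].
Proof.
rewrite /alternating /=; case: a => [|y a] /=; first by rewrite !andbT.
by rewrite -!andbA (eq_sym (0 < x)%R); case: (x != _) => //=;
  rewrite [RHS]andbA [RHS]andbC -!andbA; do !bool_congr.
Qed.

Lemma run_deletions_nseq (b : bool) (m : nat) (d : seq bool) :
  ohead d != Some b ->
  run_deletions (nseq m.+1 b ++ d) =
  (nseq m b ++ d) :: [seq nseq m.+1 b ++ e | e <- run_deletions d].
Proof.
move=> hd; elim: m => [|m IHm]; first by rewrite /= (negPf hd).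
have rdE d' : ohead d' = Some b ->
    run_deletions (b :: d') = [seq b :: e | e <- run_deletions d'].
  by move=> /= ->; rewrite eqxx.
by rewrite -[nseq m.+2 b ++ d]/(b :: nseq m.+1 b ++ d) rdE // IHm /= -map_comp.
Qed.

(* The effect of [Fstep (size p)] on the word of directions of [p ++ x :: q]. *)
Definition shorten_dirs (p : seq int) (x : int) (q : seq int) : seq bool :=
  dirs p ++ nseq `|x|.-1 (0 < x)%R ++ dirs q.

(** Since signs alternate and no entry is zero, the maximal runs of [dirs a] are exactly the blocks
    of [a]. *)
Lemma run_deletions_dirs (a : seq int) :
  alternating a ->
  run_deletions (dirs a) =
  [seq shorten_dirs (take i a) (nth 0%R a i) (drop i.+1 a) | i <- iota 0 (size a)].
Proof.
elim: a => //= x a IHa; rewrite alternating_cons => /and3P[x0 alt_a hd].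
rewrite dirs_cons -ohead_dirs // in hd *.
case def_x: `|x|%N (absz_eq0 x) => [|m]; first by rewrite (negPf x0).
move=> _; rewrite run_deletions_nseq // IHa //; congr (_ :: _).
  by rewrite /shorten_dirs /= drop0 def_x.
rewrite -[1%N]addn0 iotaDl -!map_comp.
by apply: eq_map => i /=; rewrite /shorten_dirs dirs_cons def_x -!catA.
Qed.

(** Splitting the tuple at the active entry replaces index arithmetic by the zero rules: drop a zero
    at either end, add the neighbours of an inner one. *)
Lemma Fstep_split (p q : seq int) (x : int) :
  Fstep (size p) (p ++ x :: q) =
  if star1 x != 0%R then p ++ star1 x :: q
  else if p is u :: p' then
    if q is v :: q' then belast u p' ++ (last u p' + v)%R :: q' else p
  else q.
Proof.
rewrite /Fstep nth_cat ltnn subnn /=; case: ifP => _.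
  rewrite set_nthE size_cat /= ifT; last lia.
  by rewrite take_size_cat // drop_cat ltnNge leqnSn /= subSnn /= drop0.
case: p => //= u p'; rewrite size_cat /=.
case: q => [|v q'] /=; first by rewrite addn1 eqxx /= take_size_cat.
rewrite ifF; last lia.
have -> : nth 0%R (p' ++ [:: x, v & q']) (size p').+1 = v.
  by rewrite nth_cat ltnNge leqnSn /= subSnn.
have -> : drop (size p').+2 (p' ++ [:: x, v & q']) = q'.
  by rewrite drop_cat ltnNge ltnW // -addn2 addKn /= drop0.
rewrite -cat_cons lastI cat_rcons -(size_belast u p').
by rewrite take_size_cat // nth_cat ltnn subnn.
Qed.

Lemma star1_neq0P (x : int) : x != 0%R ->
  [/\ `|star1 x|%N = `|x|.-1 & star1 x != 0%R -> ((0 < star1 x) = (0 < x))%R].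
Proof. by rewrite /star1 => x0; case: ifP => xp; split; lia. Qed.

(** When an inner entry vanishes, its neighbours have the same sign, so the word of their sum is the
    concatenation of their words and alternation survives. *)
Lemma FstepP (p q : seq int) (x : int) :
  0 < size (p ++ q) -> alternating (p ++ x :: q) ->
  inK (Fstep (size p) (p ++ x :: q)) /\
  dirs (Fstep (size p) (p ++ x :: q)) = shorten_dirs p x q.
Proof.
move=> pq_gt0 alt_a; rewrite inKE Fstep_split /shorten_dirs.
case/andP: (alt_a); rewrite all_cat map_cat /= => /and3P[nzp nzx nzq] srt.
have [absE sgE] := star1_neq0P nzx.
case: ifP => [nz|/negbFE/eqP s0].
  rewrite dirs_cat dirs_cons absE (sgE nz) /alternating; split=> //.
  by rewrite size_cat addnS /= all_cat map_cat /= (sgE nz) nz nzp nzq.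
have -> : `|x|.-1 = 0 by rewrite -absE s0.
rewrite /=; case: p pq_gt0 nzp srt alt_a => [|u p'].
  move=> -> _ _; rewrite alternating_cons => /and3P[_ -> _]; by [].
case: q nzq => [|v q'] nzq _ nzp srt alt_a.
  split; last by rewrite cats0.
  rewrite /alternating nzp /=; move: srt; rewrite /= cat_path; by case/andP.
rewrite lastI in nzp srt *.
move: (belast u p') (last u p') nzp srt => p w nzp srt {alt_a}.
rewrite map_rcons cat_rcons /= in srt; move: nzp; rewrite all_rcons => /andP[nzw nzp].
have /= /and3P[wx xv _] : sorted (fun b c : bool => b != c)
    [:: (0 < w)%R, (0 < x)%R, (0 < v)%R & [seq (0 < z)%R | z <- q']].
  by move: srt; case: (map _ p) => //= b s; rewrite cat_path => /andP[_ /= /andP[]].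
have vw : (0 < v)%R = (0 < w)%R by case: (0 < w)%R (0 < x)%R (0 < v)%R wx xv => [] [] [].
move: nzq => /= /andP[nzv nzq].
have sE : (0 < w + v)%R = (0 < w)%R by lia.
have aE : absz (w + v)%R = absz w + absz v by lia.
split; last first.
  by rewrite dirs_cat -cats1 dirs_cat !dirs_cons sE aE nseqD vw /= cats0 -!catA.
rewrite size_cat addnS /= /alternating all_cat nzp /= nzq andbT.
rewrite (_ : (w + v)%R != 0%R); last lia.
rewrite map_cat /= sE /=.
move: srt; rewrite vw; case: (map _ p) => [/= /and3P[]//|b s] /=.
by rewrite !cat_path /= => /and5P[-> -> _ _].
Qed.

Lemma num_pattern_nseq (b : bool) (m : nat) : num_pattern (nseq m b) = 1.
Proof.
elim: m => // m IHm; rewrite num_pattern_rec //.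
by have := @run_deletions_nseq b m [::] isT; rewrite !cats0 => ->; rewrite /= IHm.
Qed.

(** Both sides obey one recursion: the [i]-th run deletion of [dirs a] is the word of [Fstep i a]. A
    single block has a constant word, which only a monotone permutation realises. *)
Lemma num_pattern_dirs (a : seq int) : inK a -> num_pattern (dirs a) = PF a.
Proof.
rewrite /PF; move def_k: (lenK a) => k; elim: k a def_k => [|k IHk] a def_k aK.
  by have := size_dirs a; rewrite def_k => /size0nil ->.
rewrite inKE in aK; have [a_gt0 alt_a] := andP aK; rewrite /=; case: ifP => a_le1.
  case: a def_k a_gt0 alt_a a_le1 {aK} => [|x []] // _ _ _ _.
  by rewrite dirs_cons cats0 num_pattern_nseq.
rewrite num_pattern_rec ?size_dirs ?def_k // run_deletions_dirs // -map_comp.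
congr sumn; apply/eq_in_map => i; rewrite mem_iota /= => lt_ia.
have := @FstepP (take i a) (drop i.+1 a) (nth 0%R a i).
rewrite -drop_nth // cat_take_drop size_cat size_takel ?(ltnW lt_ia) // size_drop.
case=> [|//|inKi dirsE]; first lia.
rewrite -dirsE IHk // -size_dirs dirsE /shorten_dirs !size_cat size_nseq !size_dirs.
(* It remains that the step lowers [lenK] by exactly one, matching the fuel [k] that is left. *)
move: def_k; rewrite -{1}(cat_take_drop i a) (drop_nth 0%R lt_ia).
rewrite -size_dirs dirs_cat dirs_cons !size_cat size_nseq !size_dirs.
have : nth 0%R a i != 0%R by case/andP: alt_a => /all_nthP/(_ i lt_ia).
by rewrite -absz_gt0; case: absz => // m _; rewrite addSn addnS => -[].
Qed.

(** * Symmetry of a tuple read off its word of directions *)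

Fixpoint run_lengths (d : seq bool) : seq int :=
  if d is b :: d' then
    let s : int := if b then 1%R else (-1)%R in
    if run_lengths d' is x :: r then
      if (0 < x)%R == b then (x + s)%R :: r else [:: s, x & r]
    else [:: s]
  else [::].

Lemma run_lengths_nseq (b : bool) (m : nat) (d : seq bool) :
  ohead [seq (0 < x)%R | x <- run_lengths d] != Some b ->
  run_lengths (nseq m.+1 b ++ d) =
  (if b then m.+1%:Z else - m.+1%:Z)%R :: run_lengths d.
Proof.
move=> hd; elim: m => [|m IHm].
  rewrite /=; case: (run_lengths d) hd => [|x r] /=; first by case: b.
  by rewrite (inj_eq Some_inj) => /negPf->; case: b.
rewrite -[nseq m.+2 b ++ d]/(b :: nseq m.+1 b ++ d).
move: (nseq m.+1 b ++ d) IHm => e IHe /=; rewrite IHe.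
case: b {e IHe hd} => /=; rewrite ?oppr_gt0 /=; congr (_ :: _); lia.
Qed.

(** Makes [dirs] injective on alternating tuples, so that an equality of words yields one of
    tuples. *)
Lemma dirsK (a : seq int) : alternating a -> run_lengths (dirs a) = a.
Proof.
elim: a => //= x a IHa; rewrite alternating_cons => /and3P[x0 alt_a hd].
rewrite dirs_cons; case def_x: `|x|%N => [|m]; first by lia.
rewrite run_lengths_nseq IHa //; congr (_ :: _).
by case: ltP; lia.
Qed.

Lemma dirs_opp_rev (a : seq int) :
  all (fun x => x != 0%R) a ->
  dirs [seq (- x)%R | x <- rev a] = rev [seq ~~ b | b <- dirs a].
Proof.
elim: a => //= x a IHa /andP[x0 /IHa {}IHa].
rewrite rev_cons map_rcons -cats1 dirs_cat IHa !dirs_cons map_cat rev_cat cats0.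
rewrite map_nseq abszN; congr (_ ++ _).
have -> : (0 < - x)%R = ~~ (0 < x)%R by lia.
by elim: `|x|%N => //= m IHm; rewrite rev_cons -IHm; elim: {IHm} m => //= m <-.
Qed.

Lemma alternating_opp_rev (a : seq int) :
  alternating a -> alternating [seq (- x)%R | x <- rev a].
Proof.
case/andP=> nza srt; apply/andP; split.
  by rewrite all_map all_rev; apply: sub_all nza => x; rewrite /= oppr_eq0.
rewrite -map_comp map_rev rev_sorted.
have -> : [seq ((fun x => 0 < x) \o -%R)%R x | x <- a] =
          map negb [seq (0 < x)%R | x <- a].
  by rewrite -map_comp; apply/eq_in_map => x /(allP nza) /=; lia.
by apply: homo_sorted srt => b c; rewrite (inj_eq negb_inj) eq_sym.
Qed.

(** The reversed and negated word is what the path reads when traversed backwards; symmetry thus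
    says that the reversed path has the same type. *)
Lemma sym_tupleE (a : seq int) :
  alternating a -> sym_tuple a = (rev [seq ~~ b | b <- dirs a] == dirs a).
Proof.
move=> alt_a; rewrite -dirs_opp_rev; last by case/andP: alt_a.
apply/eqP/eqP => [<- //|/(congr1 run_lengths)].
by rewrite !dirsK // alternating_opp_rev.
Qed.

(** * Recovering a path, up to reversal, from its arc set *)

Definition swap (V : Type) (p : V * V) : V * V := (p.2, p.1).

Definition orient (V : Type) (pd : V * V * bool) : V * V :=
  if pd.2 then pd.1 else swap pd.1.

Definition adjacent (V : eqType) (x : seq V) (u v : V) : bool :=
  ((u, v) \in edges x) || ((v, u) \in edges x).

Lemma size_edges (V : Type) (x : seq V) : size (edges x) = (size x).-1.
Proof. by rewrite size_zip size_behead; lia. Qed.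

Lemma edges_map (U V : Type) (f : U -> V) (x : seq U) :
  edges (map f x) = [seq (f p.1, f p.2) | p <- edges x].
Proof. by case: x => //= u x; elim: x u => //= v x IHx u; rewrite /edges /= -IHx. Qed.

Lemma edges_rcons2 (V : Type) (x : seq V) (u v : V) :
  edges (rcons (rcons x u) v) = rcons (edges (rcons x u)) (u, v).
Proof. by case: x => //= w x; elim: x w => //= z x IHx w; rewrite /edges /= -IHx. Qed.

Lemma edges_rev (V : Type) (x : seq V) :
  edges (rev x) = rev [seq swap p | p <- edges x].
Proof.
case: x => //= u x; elim: x u => //= v x IHx u.
rewrite rev_cons; have := IHx v; rewrite rev_cons => IHv.
by rewrite edges_rcons2 IHv /edges /= rev_cons.
Qed.

Lemma mem_edges (V : eqType) (x : seq V) (u v : V) :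
  (u, v) \in edges x -> (u \in x) && (v \in x).
Proof.
case: x => //= w x; elim: x w => //= z x IHx w.
rewrite in_cons => /orP[/eqP[-> ->]|/IHx /andP[uP vP]].
  by rewrite !in_cons !eqxx orbT.
by rewrite !(in_cons w) uP vP !orbT.
Qed.

Lemma edges_neq (V : eqType) (x : seq V) :
  uniq x -> all (fun p => p.1 != p.2) (edges x).
Proof.
case: x => //= u x; elim: x u => //= v x IHx u /and3P[uNvx vNx unx].
by move: uNvx; rewrite in_cons negb_or => /andP[-> _]; apply: IHx; rewrite vNx.
Qed.

Lemma adjacentC (V : eqType) (x : seq V) (u v : V) :
  adjacent x u v = adjacent x v u.
Proof. exact: orbC. Qed.

Lemma adjacent_cons2 (V : eqType) (x : seq V) (u v p q : V) :
  adjacent [:: u, v & x] p q =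
  [|| ((p == u) && (q == v)), ((q == u) && (p == v)) | adjacent (v :: x) p q].
Proof. by rewrite /adjacent /edges /= !in_cons !xpair_eqE orbACA -orbA. Qed.

Lemma adjacent_mem (V : eqType) (x : seq V) (u v : V) :
  adjacent x u v -> (u \in x) && (v \in x).
Proof. by case/orP=> /mem_edges // /andP[-> ->]. Qed.

Lemma adjacent_rev (V : eqType) (x : seq V) (u v : V) :
  adjacent (rev x) u v = adjacent x u v.
Proof.
have swapI : injective (@swap V) by case=> ? ? [? ?] [-> ->].
rewrite /adjacent edges_rev !mem_rev.
by rewrite -[(u, v)]/(swap (v, u)) -[(v, u) in X in _ || X]/(swap (u, v)) !mem_map // orbC.
Qed.

Lemma adjacent_cat2 (V : eqType) (p q : seq V) (u v : V) :
  adjacent (p ++ [:: u, v & q]) u v.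
Proof.
case: p => [|w p]; first by rewrite adjacent_cons2 !eqxx.
elim: p w => [|z p IHp] w; first by rewrite !adjacent_cons2 !eqxx /= !orbT.
by rewrite /= adjacent_cons2; have := IHp z => /= ->; rewrite !orbT.
Qed.

Lemma adjacent_head (V : eqType) (x : seq V) (u v w : V) :
  u \notin v :: x -> adjacent [:: u, v & x] u w -> w = v.
Proof.
move=> uN; rewrite adjacent_cons2 eqxx /= => /or3P[/eqP //||/adjacent_mem].
  by move: uN; rewrite in_cons negb_or => /andP[/negPf->]; rewrite andbF.
by rewrite (negPf uN).
Qed.

(** The common end [z] has one neighbour, which must be the next vertex of both paths; then [z] is
    peeled off. *)
Lemma adjacent_inj_head (V : eqType) (z : V) (x y : seq V) :
  uniq (z :: x) -> uniq (z :: y) -> adjacent (z :: x) =2 adjacent (z :: y) ->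
  x = y.
Proof.
elim: x y z => [|u x IHx] [|v y] z //.
- by move=> _ _ /(_ z v); rewrite adjacent_cons2 !eqxx.
- by move=> _ _ /(_ z u); rewrite adjacent_cons2 !eqxx.
move=> /andP[zNux unux] /andP[zNvy unvy] eq_adj.
have eq_uv : u = v.
  by apply: (adjacent_head zNvy); rewrite -eq_adj adjacent_cons2 !eqxx.
subst v; congr (_ :: _); apply: (IHx y u) => // p q.
(* Pairs meeting [z] are adjacent in neither remaining path; for all others the removed edge is
   irrelevant. *)
have zN s : z \notin u :: s -> (p == z) || (q == z) -> adjacent (u :: s) p q = false.
  move=> zNs pq_z; apply: contraNF zNs => /adjacent_mem /andP[].
  by case/orP: pq_z => /eqP ->.
have [pq_z|] := boolP ((p == z) || (q == z)); first by rewrite !zN.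
rewrite negb_or => /andP[/negPf pz /negPf qz].
by have := eq_adj p q; rewrite !adjacent_cons2 pz qz.
Qed.

(* An end vertex has a single neighbour, so it is an end of any path
   with the same adjacencies. *)
Lemma adjacent_inj (V : eqType) (x y : seq V) :
  1 < size x -> uniq x -> uniq y -> adjacent x =2 adjacent y ->
  y = x \/ y = rev x.
Proof.
case: x => [|u [|v x]] //= _ unx uny eq_adj.
have /andP[uy _] : (u \in y) && (v \in y).
  by apply: adjacent_mem; rewrite -eq_adj adjacent_cons2 !eqxx.
case/splitPr: uy uny eq_adj => p q uny eq_adj.
have uN : u \notin v :: x by case/andP: unx.
case: p uny eq_adj => [|w p] uny eq_adj.
  by left; congr (_ :: _); apply/esym/(@adjacent_inj_head _ u).
case: q uny eq_adj => [|t q] uny eq_adj.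
  right; apply: (canRL revK); rewrite !cats1 in uny eq_adj *; rewrite rev_rcons.
  congr (_ :: _); apply/esym/(@adjacent_inj_head _ u) => //.
    by rewrite -rev_rcons rev_uniq.
  by move=> a b; rewrite -rev_rcons adjacent_rev eq_adj.
(* If [u] were interior to [y], both its neighbours there would equal [v], against [uniq y]. *)
case/lastP: {w p}(w :: p) uny eq_adj (isT : w :: p != [::]) => // p w uny eq_adj _.
rewrite cat_rcons in uny eq_adj.
have wv : w = v.
  by apply: (adjacent_head uN); rewrite eq_adj adjacentC adjacent_cat2.
have tv : t = v.
  by apply: (adjacent_head uN); rewrite eq_adj -cat_rcons adjacent_cat2.
by move: uny; rewrite cat_uniq wv tv /= !in_cons eqxx !orbT !andbF.
Qed.

(** Orienting keeps or swaps the ends of an edge, so unordered pairs survive and an arc set reveals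
    the adjacencies. *)
Lemma mem_orient (V : eqType) (E : seq (V * V)) (d : seq bool) (u v : V) :
  size E = size d ->
  ((u, v) \in map (@orient V) (zip E d)) || ((v, u) \in map (@orient V) (zip E d)) =
  ((u, v) \in E) || ((v, u) \in E).
Proof.
elim: E d => [|[p q] E IHE] [|b d] //= [/IHE {}IHE].
rewrite !in_cons orbACA IHE [RHS]orbACA; congr (_ || _).
by case: b; rewrite /orient /swap /= !xpair_eqE // orbC; congr (_ || _); rewrite andbC.
Qed.

Lemma adjacent_arcset (V : finType) (a : seq int) (x : seq V) (u v : V) :
  size x = (size (dirs a)).+1 ->
  adjacent x u v = ((u, v) \in arcset a x) || ((v, u) \in arcset a x).
Proof.
by move=> sx; rewrite !inE [RHS](@mem_orient V (edges x)) // size_edges sx.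
Qed.

Lemma arcset_rev (V : finType) (a : seq int) (x : seq V) :
  size x = (size (dirs a)).+1 -> rev [seq ~~ b | b <- dirs a] = dirs a ->
  arcset a (rev x) = arcset a x.
Proof.
move=> sx symd; apply/setP => e; rewrite !inE.
(* Only on the left is the word replaced by its reversed negation: the negated letters then cancel
   the swapped edges. *)
rewrite -[in LHS]symd edges_rev -rev_zip; last by rewrite !size_map size_edges sx.
rewrite map_rev mem_rev; congr (e \in _).
by elim: (edges x) (dirs a) => [|[p q] E IHE] [|[] d] //=; rewrite IHE.
Qed.

(** * Typed paths of the transitive tournament as permutations *)

Lemma typed_path_TT (n : nat) (a : seq int) (x : seq 'I_n) :
  is_typed_path (TT n) a x =
  [&& uniq x, size x == (size (dirs a)).+1 & pattern (map val x) == dirs a].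
Proof.
rewrite /is_typed_path /pattern edges_map -map_comp.
case unx: (uniq x) => //=; congr (_ && _); have := edges_neq unx.
elim: (edges x) (dirs a) => [|[u v] E IHE] [|b d] //= /andP[neq_uv /IHE ->].
rewrite eqseq_cons; congr (_ && _); rewrite /TT.
(* As [u] and [v] differ, the arc from [v] to [u] is present exactly when [u < v] fails. *)
by move: neq_uv; rewrite -val_eqE /=; case: b; case: ltngtP.
Qed.

Lemma pattern_rev (x : seq nat) :
  uniq x -> pattern (rev x) = rev [seq ~~ b | b <- pattern x].
Proof.
move=> /edges_neq /allP neq; rewrite /pattern edges_rev map_rev -!map_comp.
by congr rev; apply/eq_in_map => -[u v] /neq /=; case: ltngtP.
Qed.

Lemma typed_path_TT_rev (n : nat) (a : seq int) (x : seq 'I_n) :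
  is_typed_path (TT n) a x ->
  is_typed_path (TT n) a (rev x) = (rev [seq ~~ b | b <- dirs a] == dirs a).
Proof.
rewrite !typed_path_TT rev_uniq size_rev => /and3P[unx -> /eqP patx].
by rewrite unx map_rev pattern_rev ?patx // map_inj_uniq //; apply: val_inj.
Qed.

Definition typed_paths (a : seq int) (n : nat) : {set (size (dirs a)).+1.-tuple 'I_n} :=
  [set t | is_typed_path (TT n) a (val t)].

Lemma card_typed_paths (a : seq int) :
  #|typed_paths a (size (dirs a)).+1| = num_pattern (dirs a).
Proof.
set m := size (dirs a).
pose f (t : m.+1.-tuple 'I_m.+1) := map val (val t).
rewrite cardE -(size_map f) /num_pattern -size_filter; apply: perm_size.
apply: uniq_perm; first 1 last.
- by rewrite filter_uniq // permutations_uniq.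
- move=> y; rewrite mem_filter mem_permutations; apply/mapP/andP.
    case=> t; rewrite mem_enum inE typed_path_TT => /and3P[unt st patt] ->.
    split=> //; have unf : uniq (f t) by rewrite map_inj_uniq //; apply: val_inj.
    apply: uniq_perm; rewrite ?iota_uniq //.
    (* The [m.+1] values are distinct and below [m.+1], so they exhaust [iota 0 m.+1]. *)
    have [||_ //] := @uniq_min_size _ (f t) (iota 0 m.+1) unf; last by rewrite size_iota size_map size_tuple.
    by move=> i /mapP[j _ ->]; rewrite mem_iota /= add0n ltn_ord.
  case=> patt yP; have sy : size (map (@inord m) y) == m.+1.
    by rewrite size_map (perm_size yP) size_iota.
  have yE : y = f (Tuple sy).
    rewrite /f /= -map_comp -[LHS]map_id; apply/eq_in_map => i.
    by rewrite (perm_mem yP) mem_iota /= => lt_im; rewrite inordK.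
  exists (Tuple sy) => //; rewrite mem_enum inE typed_path_TT -/(f _) -yE patt sy.
  by rewrite andbT (@map_uniq _ _ val) // -/(f (Tuple sy)) -yE (perm_uniq yP) iota_uniq.
by rewrite map_inj_uniq ?enum_uniq // => s t /(inj_map val_inj) /val_inj.
Qed.

(** * From vertex sequences to arc sets: one or two sequences per path *)

Lemma arcset_eq (n : nat) (a : seq int) (s t : (size (dirs a)).+1.-tuple 'I_n) :
  0 < size (dirs a) -> s \in typed_paths a n -> t \in typed_paths a n ->
  arcset a (val s) = arcset a (val t) -> val t = val s \/ val t = rev (val s).
Proof.
rewrite !inE => d_gt0 /and3P[uns /eqP ss _] /and3P[unt /eqP st _] eq_arcs.
apply: adjacent_inj => //; first by rewrite ss.
by move=> u v; rewrite !(@adjacent_arcset _ a) // eq_arcs.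
Qed.

Lemma rev_neq (V : eqType) (x : seq V) : 1 < size x -> uniq x -> rev x != x.
Proof.
case: x => [|u [|v x]] // _ unx; apply/eqP => /(congr1 (head u)).
rewrite rev_cons -nth0 nth_rcons size_rev /= nth_rev // subn1 /= => eq_u.
by case/andP: unx => /negP[]; rewrite -{1}eq_u mem_nth.
Qed.

(** The reversal of a typed path is never typed here, so [arcset] is injective on typed paths. *)
Lemma fT_nonsym (n : nat) (a : seq int) :
  0 < size (dirs a) -> alternating a -> ~~ sym_tuple a ->
  fT (TT n) a = #|typed_paths a n|.
Proof.
move=> d_gt0 alt_a nsym; rewrite /fT /typed_paths.
apply: card_in_imset => s t sP tP eq_arcs; apply/esym/val_inj.
have [] // := arcset_eq d_gt0 sP tP eq_arcs => eq_ts.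
move: sP tP; rewrite !inE eq_ts => /typed_path_TT_rev->.
by rewrite -sym_tupleE // (negPf nsym).
Qed.

Lemma fT_sym (n : nat) (a : seq int) :
  0 < size (dirs a) -> alternating a -> sym_tuple a ->
  2 * fT (TT n) a = #|typed_paths a n|.
Proof.
move=> d_gt0 alt_a; rewrite sym_tupleE // => /eqP symd.
set D := typed_paths a n; pose f (t : (size (dirs a)).+1.-tuple 'I_n) := arcset a (val t).
rewrite -[fT _ _]/#|f @: D| mulnC -sum_nat_const.
(* Typed paths are counted by the fibres of [arcset]; each fibre is a path with its reversal, which
   differ. *)
rewrite -[RHS]sum1_card (partition_big_imset f) /=; apply: eq_bigr => A /imsetP[t tP ->].
have revD : [tuple of rev t] \in D.
  by move: tP; rewrite !inE => /typed_path_TT_rev->; rewrite symd.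
have neq : [tuple of rev t] != t.
  move: (tP); rewrite inE => /and3P[unt _ _].
  by rewrite -val_eqE rev_neq // size_tuple.
have -> : 2 = #|[set t; [tuple of rev t]]| by rewrite cards2 eq_sym neq.
rewrite sum1_card; apply: eq_card => s; rewrite !inE; apply/orP/andP.
  by case=> /eqP->; rewrite ?tP ?revD // /f arcset_rev ?size_tuple.
case=> sD /eqP eq_f.
have [eq_st|eq_st] := arcset_eq d_gt0 tP sD (esym eq_f).
  by left; apply/eqP/val_inj.
by right; apply/eqP/val_inj.
Qed.

Theorem theorem1 (n : nat) (a : seq int) :
  (2 <= n)%N -> inK a -> lenK a = n.-1 ->
  (~~ sym_tuple a -> fT (TT n) a = PF a) /\
  (sym_tuple a -> 2 * fT (TT n) a = PF a).
Proof.
move=> n_gt1 aK; rewrite -size_dirs -num_pattern_dirs // => size_d.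
have alt_a : alternating a by move: aK; rewrite inKE => /andP[].
have d_gt0 : 0 < size (dirs a) by lia.
(* The paths are Hamiltonian, as [card_typed_paths] requires. *)
have -> : n = (size (dirs a)).+1 by lia.
by rewrite -card_typed_paths; split=> symP; [apply: fT_nonsym|apply: fT_sym].
Qed.
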